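(* Let $D$ be an oriented graph (no loops, at most one arc between any two vertices) whose underlying graph is connected. Then $\chi_d(D)=2$ if and only if the underlying graph of $D$ is a complete bipartite graph $K_{m,n}$ (with $m,n\ge 1$) with partite sets $X$ and $Y$ such that $xy\in A(D)$ for all $x\in X$ and all $y\in Y$.
   Context: For a digraph $D$ and $v\in V(D)$, $N^+(v)=\{u: vu\in A(D)\}$. A dominator coloring of $D$ is a partition of $V(D)$ into color classes such that (i) it is a proper coloring of the underlying graph (adjacent vertices receive different colors), and (ii) every vertex $v$ with at least one out-neighbor dominates some color class, i.e., there is a color class $C$ with $C\subseteq N^+(v)$; vertices of out-degree $0$ are not required to dominate anything. $\chi_d(D)$ is the minimum number of color classes in a dominator coloring of $D$ (for this specific digraph $D$). *)

(* Defs.v *)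
From HB Require Import structures.
From mathcomp Require Import all_boot.

Set Implicit Arguments.
Unset Strict Implicit.
Unset Printing Implicit Defensive.

(* A finite digraph is given by its arc relation on a finite vertex type:     *)
(* "arc x y" means that xy is an arc, directed from x to y.                   *)

Section Digraph.
Variables (V : finType) (arc : rel V).

Definition oriented : Prop :=
  irreflexive arc /\ forall x y : V, arc x y -> ~~ arc y x.

(* Adjacency in the underlying graph. *)
Definition adj : rel V := [rel x y | arc x y || arc y x].

Definition out_nbrs (v : V) : {set V} := [set u | arc v u].

Definition underlying_connected : Prop :=
  0 < #|V| /\ forall x y : V, connect adj x y.

(* The members of a "partition" are nonempty: an empty color class would      *)
(* be dominated by every vertex.                                              *)
Definition dominator_coloring (P : {set {set V}}) : bool :=
  [&& partition P [set: V],
      [forall C in P, forall x in C, forall y in C, ~~ adj x y]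
    & [forall v, (out_nbrs v != set0) ==>
                 [exists C in P, C \subset out_nbrs v]]].

Definition singletons : {set {set V}} := [set [set x] | x : V].

(* The singleton coloring only serves as the witness required by "arg min";   *)
(* when there are no loops it is a dominator coloring (singletons_dominator), *)
(* so that chi_d is the minimum (chi_dP).                                     *)
Definition chi_d : nat :=
  #|[arg min_(P < singletons | dominator_coloring P) #|P|]|.

Definition complete_bipartite_with (X Y : {set V}) : Prop :=
  [/\ X :|: Y = [set: V], [disjoint X & Y], 1 <= #|X|, 1 <= #|Y|
    & forall x y : V,
        adj x y = (x \in X) && (y \in Y) || (x \in Y) && (y \in X)].

Lemma singletons_dominator : irreflexive arc -> dominator_coloring singletons.
Proof.
move=> irr; apply/and3P; split.
- apply/and3P; split.
  + apply/eqP/setP=> x; rewrite inE; apply/bigcupP.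
    by exists [set x]; [apply: imset_f | apply: set11].
  + apply/trivIsetP=> _ _ /imsetP[x _ ->] /imsetP[y _ ->] nxy.
    by rewrite disjoints1 inE; apply: contraNneq nxy => ->.
  + by apply/imsetP=> -[x _ /setP/(_ x)]; rewrite !inE eqxx.
- apply/forall_inP=> _ /imsetP[z _ ->].
  apply/forall_inP=> x /set1P->; apply/forall_inP=> y /set1P->.
  by rewrite /adj /= irr.
- apply/forallP=> v; apply/implyP=> /set0Pn[u vu].
  by apply/exists_inP; exists [set u]; rewrite ?imset_f ?sub1set.
Qed.

Lemma chi_dP : irreflexive arc ->
  (exists2 P, dominator_coloring P & #|P| = chi_d) /\
  (forall P, dominator_coloring P -> chi_d <= #|P|).
Proof.
move=> irr; rewrite /chi_d.
by case: arg_minnP => [|P dP minP]; [apply: singletons_dominator | split; [exists P|]].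
Qed.

End Digraph.

(* Main.v *)
Require Import Defs.
From mathcomp Require Import all_boot.

(** In a dominator coloring by two classes [A] and [B], a vertex of [A] having
    an out-neighbor cannot dominate its own class, so it points to all of [B].
    By orientedness the vertices of [B] then have no out-neighbor at all, so
    that every vertex of [A], not being isolated, points to all of [B] as well. *)

Section DominatorColoring.
Set Implicit Arguments.
Unset Strict Implicit.
Variables (V : finType) (arc : rel V).
Implicit Types (A B X Y : {set V}) (P : {set {set V}}).

(** A path from [x] to a different vertex [y] has at least one edge, and its first edge gives the
    neighbor. This is how connectedness excludes isolated vertices. *)
Lemma connected_neighbor (x y : V) :
  underlying_connected arc -> x != y -> exists z, adj arc x z.
Proof.
case=> _ /(_ x y)/connectP[[|z p] /= xp ->]; first by rewrite eqxx.
by case/andP: xp; exists z.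
Qed.

Lemma dominator_coloring_proper P A x y :
  dominator_coloring arc P -> A \in P -> x \in A -> y \in A -> ~~ adj arc x y.
Proof.
case/and3P=> _ /forall_inP proper _ AP xA yA.
by have /forall_inP/(_ x xA)/forall_inP/(_ y yA) := proper A AP.
Qed.

Lemma two_coloring_out_nbrs A B x u :
  dominator_coloring arc [set A; B] -> x \in A -> arc x u ->
  forall y, y \in B -> arc x y.
Proof.
move=> dP xA xu y yB; case/and3P: (dP) => _ _ /forallP/(_ x)/implyP dom.
have [|C] := exists_inP (dom _); first by apply/set0Pn; exists u; rewrite inE.
case/set2P=> -> /subsetP sub; last by have := sub y yB; rewrite inE.
(* If the dominated class is [A] itself, then [x] is its own out-neighbor, and properness at the
   pair [x], [x] forbids this loop. *)
have := dominator_coloring_proper dP (set21 A B) xA xA.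
by have := sub x xA; rewrite inE /adj /= => ->.
Qed.

(** The one arc [xu] breaks the symmetry between the classes: the class of its tail becomes the side
    from which all arcs leave. *)
Lemma two_coloring_complete_bipartite A B x u :
  oriented arc -> underlying_connected arc -> A != B ->
  dominator_coloring arc [set A; B] -> x \in A -> arc x u ->
  complete_bipartite_with arc A B /\
  (forall y z, y \in A -> z \in B -> arc y z).
Proof.
move=> [_ asym] conn nAB dP xA xu.
have [/and3P[/eqP covP trivP P0] _ _] := and3P dP.
have AorB y : y \in A \/ y \in B.
  have := in_setT y; rewrite -covP => /bigcupP[C /set2P[]-> yC]; by [left|right].
have disAB : [disjoint A & B].
  by apply: (trivIsetP trivP); rewrite ?set21 ?set22.
have properA y z : y \in A -> z \in A -> arc y z = false.
  move=> yA zA; apply: contraNF (dominator_coloring_proper dP (set21 A B) yA zA).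
  by rewrite /adj /= => ->.
have B_sink y z : y \in B -> arc y z = false.
  move=> yB; apply/negP=> yz.
  (* With the roles of [A] and [B] exchanged, an out-neighbor of [y] makes [y] point to all of [A],
     against the arc from [x] to [y]. *)
  have yx : arc y x.
    by apply: (two_coloring_out_nbrs _ yB yz xA); rewrite setUC.
  by have := asym _ _ yx; rewrite (two_coloring_out_nbrs dP xA xu).
have AtoB y z : y \in A -> z \in B -> arc y z.
  move=> yA zB.
  (* The edge at [y] must leave [y]: an arc from [t] to [y] would lie inside [A] or start at a sink
     in [B]. *)
  have [|t] := @connected_neighbor y z conn.
    by apply: contraTneq zB => <-; rewrite (disjointFr disAB).
  rewrite /adj /= => /orP[yt|ty].
    exact: (two_coloring_out_nbrs dP yA yt zB).
  case: (AorB t) => [tA|tB]; first by rewrite properA in ty.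
  by rewrite B_sink in ty.
split=> //; split=> //.
- by apply/setP=> y; rewrite !inE; case: (AorB y) => ->; rewrite ?orbT.
- by apply/card_gt0P; exists x.
- by rewrite card_gt0; apply: contraNneq P0 => <-; rewrite set22.
move=> y z; rewrite /adj /=.
case: (AorB y) (AorB z) => [yA|yB] [zA|zB].
- by rewrite !properA // yA zA !(disjointFr disAB).
- by rewrite (AtoB y z) // yA zB.
- by rewrite (AtoB z y) // orbT yB zA orbT.
- by rewrite !B_sink // yB zB !(disjointFl disAB).
Qed.

(** The ends of an edge lie in two different blocks. This yields the lower bound on [chi_d]. *)
Lemma adj_card_coloring_gt1 P x y :
  dominator_coloring arc P -> adj arc x y -> 1 < #|P|.
Proof.
move=> dP xy; have [/and3P[/eqP covP _ _] _ _] := and3P dP.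
have inP z : (pblock P z \in P) * (z \in pblock P z).
  by rewrite pblock_mem ?mem_pblock ?covP ?inE.
have npb : pblock P x != pblock P y.
  apply: contraTneq xy => eqp.
  by apply: (dominator_coloring_proper dP (inP x).1); rewrite ?inP // eqp inP.
suff /subset_leq_card : [set pblock P x; pblock P y] \subset P.
  by rewrite cards2 npb.
by apply/subsetP=> C /set2P[]->; rewrite inP.
Qed.

Lemma complete_bipartite_dominator X Y :
  oriented arc -> complete_bipartite_with arc X Y ->
  (forall x y, x \in X -> y \in Y -> arc x y) ->
  dominator_coloring arc [set X; Y].
Proof.
move=> [_ asym] [covXY disXY X0 Y0 adjE] XtoY.
have XorY y : y \in X \/ y \in Y.
  by have := in_setT y; rewrite -covXY => /setUP.
apply/and3P; split.
- apply/and3P; split.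
  + by rewrite /cover bigcup_setU !big_set1 covXY.
  + apply/trivIsetP=> _ _ /set2P[]-> /set2P[]->; rewrite ?eqxx //.
    by rewrite disjoint_sym.
  + by apply/set2P=> -[] E; move: X0 Y0; rewrite -E cards0.
- apply/forall_inP=> _ /set2P[]->; apply/forall_inP=> x xC;
    apply/forall_inP=> y yC; rewrite adjE xC yC.
  + by rewrite !(disjointFr disXY).
  + by rewrite !(disjointFl disXY).
- apply/forallP=> x; apply/implyP=> /set0Pn[u]; rewrite inE => xu.
  (* Every vertex with an out-neighbor dominates [Y], since it must lie in [X]: an arc from [Y]
     would end in [X] and oppose an arc from [X] to [Y]. *)
  apply/exists_inP; exists Y; first exact: set22.
  suff xX : x \in X by apply/subsetP=> y yY; rewrite inE XtoY.
  case: (XorY x) => // xY.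
  have : adj arc x u by rewrite /adj /= xu.
  rewrite adjE xY (disjointFl disXY) //= => uX.
  by have := asym _ _ xu; rewrite XtoY.
Qed.

End DominatorColoring.

Theorem theorem3 (V : finType) (arc : rel V)
  (h_oriented : oriented arc) (h_connected : underlying_connected arc) :
  chi_d arc = 2 <->
  exists X Y : {set V},
    complete_bipartite_with arc X Y /\
    (forall x y : V, x \in X -> y \in Y -> arc x y).
Proof.
have [[P dP cardP] minP] := chi_dP h_oriented.1; split=> [chi2 | [X [Y [bip XtoY]]]].
  have /cards2P[A [B [nAB defP]]] : #|P| == 2 by rewrite cardP chi2.
  rewrite defP in dP.
  have [/and3P[/eqP covP trivP P0] _ _] := and3P dP.
  have [x xA] : exists x, x \in A.
    by apply/set0Pn; apply: contraNneq P0 => <-; rewrite set21.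
  have [y yB] : exists y, y \in B.
    by apply/set0Pn; apply: contraNneq P0 => <-; rewrite set22.
  have disAB : [disjoint A & B].
    by apply: (trivIsetP trivP); rewrite ?set21 ?set22.
  have nxy : x != y.
    by apply: contraTneq yB => <-; rewrite (disjointFr disAB).
  have [s [t st]] : exists s t, arc s t.
    have [z /orP[xz|zx]] := connected_neighbor h_connected nxy.
      by exists x, z.
    by exists z, x.
  (* The class containing the tail [s] is taken as [X]. *)
  have := in_setT s; rewrite -covP => /bigcupP[C /set2P[]-> sC].
    by exists A, B; apply: (two_coloring_complete_bipartite _ _ _ _ _ st).
  exists B, A; apply: (two_coloring_complete_bipartite _ _ _ _ _ st) => //.
    by rewrite eq_sym.
  by rewrite setUC.
have [covXY disXY /card_gt0P[x xX] /card_gt0P[y yY] _] := bip.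
have xy : adj arc x y by rewrite /adj /= XtoY.
(* The edge [xy] forces two classes in the optimal coloring [P]; the coloring by [X] and [Y] gives
   the upper bound. *)
apply/eqP; rewrite eqn_leq -{2}cardP (adj_card_coloring_gt1 dP xy) andbT.
have := minP _ (complete_bipartite_dominator h_oriented bip XtoY).
by move/leq_trans; apply; rewrite cards2; case: (_ != _).
Qed.
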